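(* There exist cw-expansive homeomorphisms of the 2-torus $\mathbb T^2$ that have infinitely many fixed points and empty wandering set.
   Context: A continuum is a non-empty compact connected set; it is trivial if it is a single point. A homeomorphism $f\colon M\to M$ of a compact metric space $(M,\operatorname{dist})$ is cw-expansive if there is $\xi>0$ such that every continuum $C\subseteq M$ with $\operatorname{diam} f^n(C)\le\xi$ for all $n\in\mathbb Z$ is trivial (this does not depend on the choice of compatible metric). A point $x\in M$ is wandering for $f$ if there is an open set $U$ containing $x$ such that $U\cap f^n(U)=\varnothing$ for all $n\ne0$; the wandering set is the set of wandering points. *)

(* Defs.v *)
From HB Require Import structures.
From mathcomp Require Import all_boot all_order all_algebra generic_quotient.
From mathcomp Require Import all_classical all_reals.
From mathcomp Require Import topology ereal normedtype.
From mathcomp Require Import ring lra.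

Set Implicit Arguments.
Unset Strict Implicit.
Unset Printing Implicit Defensive.

Import Order.TTheory GRing.Theory Num.Theory.
Import numFieldNormedType.Exports.

Local Open Scope classical_set_scope.
Local Open Scope ring_scope.
Local Open Scope quotient_scope.

Section homeomorphisms.
Context {M : topologicalType}.

Record homeomorphism := Homeomorphism {
  homeo_fun :> M -> M ;
  homeo_inv : M -> M ;
  homeo_funK : cancel homeo_fun homeo_inv ;
  homeo_invK : cancel homeo_inv homeo_fun ;
  homeo_fun_continuous : continuous homeo_fun ;
  homeo_inv_continuous : continuous homeo_inv }.

Definition iterz (f : homeomorphism) (n : int) : M -> M :=
  match n with
  | Posz k => iter k f
  | Negz k => iter k.+1 (homeo_inv f)
  end.

Definition continuum (C : set M) : Prop :=
  [/\ C !=set0, compact C & connected C].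

Definition wandering_point (f : homeomorphism) (x : M) : Prop :=
  exists U : set M, [/\ open U, U x &
    forall n : int, n != 0 -> U `&` (iterz f n @` U) = set0].

Definition wandering_set (f : homeomorphism) : set M :=
  [set x | wandering_point f x].

Definition fixed_points (f : homeomorphism) : set M := [set x | f x = x].

End homeomorphisms.
Arguments homeomorphism : clear implicits.

Section cw_expansivity.
Context {R : realType} {M : metricType R}.

(* Extended-real valued, so that an unbounded set has diameter +oo rather than
   the default value of the real-valued sup. *)
Definition diam (A : set M) : \bar R :=
  ereal_sup [set (mdist x y)%:E | x in A & y in A].

Definition cw_expansive (f : homeomorphism M) : Prop :=
  exists2 xi : R, 0 < xi &
    forall C : set M, continuum C ->
      (forall n : int, (diam (iterz f n @` C) <= xi%:E)%E) ->
      exists x, C = [set x].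

End cw_expansivity.

Section torus.
Context {R : realType}.
Implicit Types x y z : R * R.

Definition lattice_eq x y : bool :=
  (x.1 - y.1 \is a Num.int) && (x.2 - y.2 \is a Num.int).

Lemma lattice_eq_refl : reflexive lattice_eq.
Proof. by move=> x; rewrite /lattice_eq !subrr rpred0. Qed.

Lemma lattice_eq_sym : symmetric lattice_eq.
Proof. by move=> x y; rewrite /lattice_eq -[x.1 - _]opprB -[x.2 - _]opprB !rpredN. Qed.

Lemma lattice_eq_trans : transitive lattice_eq.
Proof.
move=> y x z /andP[a b] /andP[c d]; rewrite /lattice_eq.
have -> : x.1 - z.1 = (x.1 - y.1) + (y.1 - z.1) by ring.
have -> : x.2 - z.2 = (x.2 - y.2) + (y.2 - z.2) by ring.
by rewrite (rpredD a c) (rpredD b d).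
Qed.

Canonical lattice_eq_equiv :=
  EquivRel lattice_eq lattice_eq_refl lattice_eq_sym lattice_eq_trans.

End torus.

Definition torus (R : realType) : Type := {eq_quot (@lattice_eq R)}.

HB.instance Definition _ (R : realType) := Choice.on (torus R).
HB.instance Definition _ (R : realType) := EqQuotient.on (torus R).

Section torus_metric.
Context {R : realType}.
Implicit Types (x y z : R * R) (p q r : torus R).

Definition torus_pi x : torus R := \pi_(torus R) x.

(* The distance induced on R^2/Z^2 by the norm of R * R, which in the library is
   the sup norm max(|x.1|, |x.2|). *)
Definition torus_dist p q : R :=
  inf [set `|x - y| | x in torus_pi @^-1` [set p] & y in torus_pi @^-1` [set q]].

Lemma torus_piP x y :
  torus_pi x = torus_pi y <->
  (x.1 - y.1 \is a Num.int) && (x.2 - y.2 \is a Num.int).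
Proof.
by split=> [/eqquotP//|h]; apply/eqquotP.
Qed.

Lemma torus_pi_surj p : exists x, torus_pi x = p.
Proof. by exists (repr p); rewrite /torus_pi reprK. Qed.

Let has_inf_dist p q : has_inf
  [set `|x - y| | x in torus_pi @^-1` [set p] & y in torus_pi @^-1` [set q]].
Proof.
have [x xp] := torus_pi_surj p; have [y yq] := torus_pi_surj q.
split; first by exists `|x - y|, x => //; exists y.
by exists 0 => _ [? _ [? _ <-]].
Qed.

Lemma torus_dist_le x y : torus_dist (torus_pi x) (torus_pi y) <= `|x - y|.
Proof.
apply: ge_inf; last by exists x => //; exists y.
by have [] := has_inf_dist (torus_pi x) (torus_pi y).
Qed.

Lemma torus_dist_approx p q (e : R) : 0 < e -> exists x y,
  [/\ torus_pi x = p, torus_pi y = q & `|x - y| < torus_dist p q + e].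
Proof.
move=> e0; have [_ [x xp [y yq <-]] h] := inf_adherent e0 (has_inf_dist p q).
by exists x, y.
Qed.

Lemma torus_dist_ge0 p q : 0 <= torus_dist p q.
Proof.
apply: lb_le_inf; first by have [] := has_inf_dist p q.
by move=> _ [? _ [? _ <-]].
Qed.

Lemma torus_pi_shift x z :
  z.1 \is a Num.int -> z.2 \is a Num.int -> torus_pi (x + z) = torus_pi x.
Proof.
move=> z1 z2; apply/torus_piP => /=.
by rewrite [x.1 + _]addrC [x.2 + _]addrC !addrK z1 z2.
Qed.

Lemma torus_distxx p : torus_dist p p = 0.
Proof.
have [x <-] := torus_pi_surj p; apply/eqP; rewrite eq_le torus_dist_ge0 andbT.
by rewrite (le_trans (torus_dist_le x x))// subrr normr0.
Qed.

Lemma torus_dist_sym p q : torus_dist p q = torus_dist q p.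
Proof.
suff h p' q' : torus_dist p' q' <= torus_dist q' p'.
  by apply/eqP; rewrite eq_le !h.
apply/ler_addgt0Pl => e e0; have [x [y [<- <- h]]] := torus_dist_approx q' p' e0.
by rewrite (le_trans (torus_dist_le y x))// distrC [e + _]addrC ltW.
Qed.

Lemma torus_dist_triangle q p r :
  torus_dist p r <= torus_dist p q + torus_dist q r.
Proof.
apply/ler_addgt0Pl => e e0.
have e20 : 0 < e / 2 by rewrite divr_gt0.
have [x [y [xp yq h1]]] := torus_dist_approx p q e20.
have [y' [z [y'q zr h2]]] := torus_dist_approx q r e20.
have /torus_piP/andP[i1 i2] : torus_pi y = torus_pi y' by rewrite yq y'q.
have -> : torus_dist p r = torus_dist (torus_pi x) (torus_pi (z + (y - y'))).
  by rewrite torus_pi_shift// xp zr.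
apply: le_trans (torus_dist_le _ _) _.
have -> : x - (z + (y - y')) = (x - y) + (y' - z).
  by rewrite !opprD opprK addrA [RHS]addrA -!addrA; congr +%R; rewrite addrC addrA.
by apply: le_trans (ler_normD _ _) _; lra.
Qed.

Let int_gap (t : R) : t \isn't a Num.int ->
  exists2 d : R, 0 < d & forall s, s - t \is a Num.int -> d <= `|s|.
Proof.
move=> tNint; set n := Num.floor t.
have /andP[] : n%:~R <= t < (n + 1)%:~R by exact: real_floor_itv (num_real t).
rewrite le_eqVlt => /predU1P[nt|nt tn].
  by move: tNint; rewrite -nt rpred_int.
exists (Num.min (t - n%:~R) ((n + 1)%:~R - t)).
  by rewrite lt_min !subr_gt0 nt tn.
move=> s /intrP[m stm]; rewrite ge_min; have [mn|mn] := lerP (- n) m.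
  have : (- n)%:~R <= m%:~R :> R by rewrite ler_int.
  by rewrite intrN => ?; have := ler_norm s; lra.
have : (m + 1)%:~R <= (- n)%:~R :> R by rewrite ler_int lezD1.
rewrite !intrD intrN => ?; apply/orP; right.
by have := ler_norm (- s); rewrite normrN; lra.
Qed.

Lemma torus_dist_eq0 p q : torus_dist p q = 0 -> p = q.
Proof.
have [x0 <-] := torus_pi_surj p; have [y0 <-] := torus_pi_surj q => pq0.
have close (e : R) : 0 < e -> exists z : R * R, [/\ `|z.1| < e, `|z.2| < e,
    z.1 - (x0.1 - y0.1) \is a Num.int & z.2 - (x0.2 - y0.2) \is a Num.int].
  move=> e0.
  have [x [y [xp yq]]] := torus_dist_approx (torus_pi x0) (torus_pi y0) e0.
  rewrite pq0 add0r gt_max => /andP[h1 h2]; exists (x - y); split => //=.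
  - have -> : x.1 - y.1 - (x0.1 - y0.1) = (x.1 - x0.1) - (y.1 - y0.1) by ring.
    by move/torus_piP/andP: xp => [? _]; move/torus_piP/andP: yq => [? _]; rewrite rpredB.
  - have -> : x.2 - y.2 - (x0.2 - y0.2) = (x.2 - x0.2) - (y.2 - y0.2) by ring.
    by move/torus_piP/andP: xp => [_ ?]; move/torus_piP/andP: yq => [_ ?]; rewrite rpredB.
apply/torus_piP/andP; split; apply/negPn/negP => /int_gap[d d0 dP].
- have [z [h _ zi _]] := close _ d0; by have := dP _ zi; rewrite leNgt h.
- have [z [_ h _ zi]] := close _ d0; by have := dP _ zi; rewrite leNgt h.
Qed.

End torus_metric.

HB.instance Definition _ (R : realType) := @isMetric.Build R (torus R)
  torus_dist torus_distxx torus_dist_eq0 torus_dist_sym torus_dist_triangle.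

Section torus_topology.
Context {R : realType}.

Lemma torus_pi_continuous : continuous (@torus_pi R).
Proof.
move=> x; apply/cvg_ballP => e e0.
apply: filterS (nbhsx_ballx x e e0) => y xy; rewrite ballEmdist /=; apply: le_lt_trans (torus_dist_le x y) _.
by move: xy; rewrite -ball_normE.
Qed.

Lemma torus_openE (U : set (torus R)) : open U <-> open (torus_pi @^-1` U).
Proof.
split; first by move: U; apply/continuousP; exact: torus_pi_continuous.
move=> oU; rewrite openE => p Up; have [x xp] := torus_pi_surj p.
have : nbhs x (torus_pi @^-1` U) by apply: open_nbhs_nbhs; split; rewrite /= ?xp.
move=> /nbhs_ballP[e /= e0 xeU]; apply/nbhs_ballP; exists e => //= q.
rewrite ballEmdist /= -subr_gt0 => pqe.
have [x' [y' [x'p <- h]]] := torus_dist_approx p q pqe.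
have /torus_piP/andP[i1 i2] : torus_pi x = torus_pi x' by rewrite xp x'p.
rewrite -(@torus_pi_shift _ y' (x - x') i1 i2); apply: xeU; rewrite -ball_normE /=.
have -> : x - (y' + (x - x')) = x' - y'.
  by rewrite !opprD opprK addrCA addNKr addrC.
by rewrite (lt_le_trans h)// addrCA subrr addr0.
Qed.

Lemma torus_compact : compact [set: torus R].
Proof.
have -> : [set: torus R] = torus_pi @` (`[0, 1]%classic `*` `[0, 1]%classic).
  apply/seteqP; split=> // p _; have [x <-] := torus_pi_surj p.
  have fr (t : R) : 0 <= t - (Num.floor t)%:~R <= 1.
    by have /andP[] := real_floor_itv (num_real t); rewrite intrD; lra.
  exists (x - ((Num.floor x.1)%:~R, (Num.floor x.2)%:~R)).
    by split; rewrite /= in_itv /=; exact: fr.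
  by rewrite torus_pi_shift //= rpredN rpred_int.
apply: continuous_compact; last by apply: compact_setX; exact: segment_compact.
by apply: continuous_subspaceT; exact: torus_pi_continuous.
Qed.

End torus_topology.

(* Main.v *)
Require Import Defs.
From mathcomp Require Import all_boot all_order all_algebra generic_quotient.
From mathcomp Require Import all_classical all_reals.
From mathcomp Require Import topology ereal normedtype.
From mathcomp Require Import ring lra.

Set Implicit Arguments.
Unset Strict Implicit.
Unset Printing Implicit Defensive.

Import Order.TTheory GRing.Theory Num.Theory.
Import numFieldNormedType.Exports.

Local Open Scope classical_set_scope.
Local Open Scope ring_scope.

(** Let phi : R -> R be continuous and compatible with congruence modulo 1.
The map f (x, y) = (phi x - y, x) is then a homeomorphism of the torus, with
inverse (x, y) |-> (y, phi y - x). Along an orbit the first coordinates obey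
the recurrence x_(n+1) + x_(n-1) = phi(x_n), and the second coordinate is the
previous first coordinate.

Suppose that phi is Lipschitz and stretches every short interval I onto a set
of diameter at least lambda * |I|, for some lambda > 2; folds are allowed.
Then f is cw-expansive ([rec_homeo_cw_expansive]). If all iterates of a
continuum C are small, let s be the supremum, over all the iterates, of the
widths of their first projections. The first projection of a connected set
contains the whole interval between any two of its points
([connected_torus_ivt]), so an iterate with first projection of width w
contains two points whose phi-values differ by lambda * w. By the recurrence
the next or the previous iterate has width at least lambda * w / 2. Hence
s >= (lambda / 2) s with s finite, so s = 0. All the iterates then have
constant first coordinate, thus C has both coordinates constant.

The folds leave room for infinitely many fixed points. Take
phi x = 2 x + 160 d(x, Z), where d is the distance to the 1-periodic set Z of
the points k + 2^-n, with k an integer and n >= 0.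

- Expansion: Z is porous at all scales up to 1 ([dyadic_comb_porous]), and d is a
  tent of slopes 1 and -1 on each gap of Z, so d oscillates by at least
  |I| / 32 on each interval I of length at most 1; the factor 160 beats the
  linear term 2 x and gives lambda = 3.

- Fixed points: phi z = 2 z for z in Z, so (z, z) is fixed.

- Wandering set: phi preserves the integer multiples of 2^-N
  ([dyadic_comb_dist]), so f permutes the finite grid of torus points with
  coordinates in 2^-N times the integers, and all the points of these grids
  are periodic. Their union over N is dense, so each nonempty open set
  meets one of its own iterates. *)

(** * Distance to a set of reals *)

Section distance_to_set.
Context {R : realType}.
Implicit Types (Z : set R) (x y z : R).

Definition set_dist Z x : R := inf [set `|x - z| | z in Z].

Lemma set_dist_le Z x z : Z z -> set_dist Z x <= `|x - z|.
Proof. by move=> Zz; apply: ge_inf; [exists 0 => _ [? _ <-]|exists z]. Qed.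

Lemma set_dist_ge Z x (m : R) :
  Z !=set0 -> (forall z, Z z -> m <= `|x - z|) -> m <= set_dist Z x.
Proof.
move=> [z0 Zz0] h; apply: lb_le_inf; first by exists `|x - z0|, z0.
by move=> _ [z Zz <-]; exact: h.
Qed.

Lemma set_dist_approx Z x (e : R) :
  Z !=set0 -> 0 < e -> exists2 z, Z z & `|x - z| < set_dist Z x + e.
Proof.
move=> [z0 Zz0] e0.
have hi : has_inf [set `|x - z| | z in Z].
  by split; [exists `|x - z0|, z0|exists 0 => _ [? _ <-]].
by have [_ [z Zz <-] h] := inf_adherent e0 hi; exists z.
Qed.

Lemma set_dist_eq0 Z z : Z z -> set_dist Z z = 0.
Proof.
move=> Zz; apply/eqP; rewrite eq_le.
have := set_dist_le z Zz; rewrite subrr normr0 => ->/=.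
by apply: set_dist_ge; [exists z|].
Qed.

Lemma set_dist_lipschitz Z x y :
  Z !=set0 -> `|set_dist Z x - set_dist Z y| <= `|x - y|.
Proof.
move=> Z0; wlog h : x y / set_dist Z y <= set_dist Z x.
  move=> wl; have [/wl//|/ltW/wl] := leP (set_dist Z y) (set_dist Z x).
  by rewrite distrC [`|y - x|]distrC.
rewrite ger0_norm ?subr_ge0// lerBlDl -lerBlDr; apply: set_dist_ge => // z Zz.
rewrite lerBlDr (le_trans (set_dist_le x Zz))//.
by rewrite [leRHS]addrC ler_distD.
Qed.

Lemma set_dist_shift Z x (t : R) :
  Z !=set0 -> (forall z, Z z -> Z (z + t)) -> (forall z, Z z -> Z (z - t)) ->
  set_dist Z (x + t) = set_dist Z x.
Proof.
move=> Z0 Zt ZNt; apply/eqP; rewrite eq_le; apply/andP.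
split; apply: set_dist_ge => // z Zz.
  have := set_dist_le (x + t) (Zt _ Zz).
  by have -> : x + t - (z + t) = x - z by ring.
have := set_dist_le x (ZNt _ Zz).
by have -> : x - (z - t) = x + t - z by ring.
Qed.

(** The midpoint m of the gap has an almost nearest point z of Z on one side of
the gap; going from m to the end of the gap on that side brings one closer to
z by (d - c) / 2. This avoids identifying the maximal gap around ]c, d[. *)
Lemma set_dist_gap Z c d : Z !=set0 -> c < d ->
  (forall z, Z z -> z <= c \/ d <= z) ->
  exists u v, [/\ c <= u <= d, c <= v <= d &
    (d - c) / 4 <= `|set_dist Z u - set_dist Z v|].
Proof.
move=> Z0 cd gap; set m := (c + d) / 2.
have e0 : 0 < (d - c) / 4 by lra.
have [z Zz hz] := set_dist_approx m Z0 e0.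
case: (gap _ Zz) => zcd; exists m.
  exists c; split; [by apply/andP; rewrite /m; lra|by rewrite lexx ltW|].
  have := set_dist_le c Zz; rewrite ger0_norm ?subr_ge0// => hc.
  move: hz; rewrite ger0_norm; last by rewrite /m; lra.
  have := ler_norm (set_dist Z m - set_dist Z c).
  by rewrite /m in hc *; lra.
exists d; split; [by apply/andP; rewrite /m; lra|by rewrite lexx ltW|].
have := set_dist_le d Zz; rewrite ler0_norm ?subr_le0// => hc.
move: hz; rewrite ler0_norm; last by rewrite /m; lra.
have := ler_norm (set_dist Z m - set_dist Z d).
by rewrite /m in hc *; lra.
Qed.

End distance_to_set.

(** * A porous periodic set preserving dyadic grids *)

Section dyadic_comb.
Context {R : realType}.
Implicit Types (x y z : R) (n N : nat).

Definition dyadic_comb : set R :=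
  [set z | exists k : int, exists n, z = k%:~R + 2 ^- n].

Lemma dyadic_comb0 : dyadic_comb !=set0.
Proof. by exists (0 + 2 ^- 0), 0, 0. Qed.

Lemma dyadic_comb_int x y :
  x - y \is a Num.int -> set_dist dyadic_comb x = set_dist dyadic_comb y.
Proof.
move=> /intrP[m xy]; have -> : x = y + m%:~R by rewrite -xy; ring.
apply: set_dist_shift; first exact: dyadic_comb0.
  by move=> _ [k [n ->]]; exists (k + m), n; rewrite intrD; ring.
by move=> _ [k [n ->]]; exists (k - m), n; rewrite intrB; ring.
Qed.

Lemma exp2N_gt0 n : 0 < 2 ^- n :> R.
Proof. by rewrite invr_gt0 exprn_gt0. Qed.

Lemma exp2N_le1 n : 2 ^- n <= 1 :> R.
Proof. by rewrite invf_le1 ?exprn_gt0// exprn_ege1// ler1n. Qed.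

Lemma exp2N_lt n N : (n < N)%N -> 2 * 2 ^- N <= 2 ^- n :> R.
Proof.
move=> nN; have -> : N = (n + (N - n.+1).+1)%N by rewrite addnS -addSn subnKC.
have := exp2N_le1 (N - n.+1); have := exp2N_gt0 n.
rewrite exprD exprS !invfM => h1 h2; nra.
Qed.

Lemma dyadic_comb_itv k z : dyadic_comb z -> k%:~R < z <= (k + 1)%:~R ->
  exists n, z = k%:~R + 2 ^- n.
Proof.
move=> [j [n ->]] /andP[h1 h2]; exists n; congr (_%:~R + _).
have e0 := exp2N_gt0 n; have e1 := exp2N_le1 n.
have : (k%:~R : R) < (j + 1)%:~R by rewrite intrD; lra.
have : (j%:~R : R) < (k + 1)%:~R by lra.
by rewrite !ltr_int !ltzD1 => a b; apply/eqP; rewrite eq_le a b.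
Qed.

(** Measured from the integer k, the interval lies in some [t, 2 t], and two
distinct powers of 2 differ by a factor of at least 2: at most one point of
the comb is interior, and one of the two sides of it has at least half the length. *)
Lemma dyadic_comb_gap_doubling k c d : 0 < c - k%:~R -> d <= (k + 1)%:~R ->
  c < d -> d - k%:~R <= 2 * (c - k%:~R) ->
  exists c' d', [/\ c <= c', c' < d', d' <= d, (d - c) / 2 <= d' - c' &
    forall z, dyadic_comb z -> z <= c' \/ d' <= z].
Proof.
move=> c0 d1 cd d2c.
have [[z [Zz zc zd]]|none] :=
    pselect (exists z, [/\ dyadic_comb z, c < z & z < d]); last first.
  exists c, d; split; rewrite ?lexx//; first lra.
  move=> z Zz; have [?|cz] := leP z c; [by left|right].
  by rewrite leNgt; apply/negP => zd; apply: none; exists z.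
have uniq w : dyadic_comb w -> c < w -> w < d -> w = z.
  move=> Zw wc wd; rewrite intrD in d1.
  have [n zn] := @dyadic_comb_itv k z Zz ltac:(rewrite intrD; apply/andP; lra).
  have [m wm] := @dyadic_comb_itv k w Zw ltac:(rewrite intrD; apply/andP; lra).
  rewrite wm zn; case: (ltngtP n m) => [/exp2N_lt|/exp2N_lt|->//] h;
    by rewrite wm zn in zc zd wc wd *; exfalso; lra.
have [h|h] := leP ((d - c) / 2) (z - c).
  exists c, z; split; rewrite ?lexx ?(ltW zd)// => w Zw.
  have [?|wc] := leP w c; [by left|right].
  by rewrite leNgt; apply/negP => wz; move: (wz); rewrite (uniq w)// ?ltxx//; lra.
exists z, d; split; rewrite ?lexx ?(ltW zc)//; first lra.
move=> w Zw; have [?|wc] := leP w z; [by left|right].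
by rewrite leNgt; apply/negP => wz; move: (wc); rewrite (uniq w)// ?ltxx//; lra.
Qed.

(** One half of [a, b] lies between two consecutive integers k and k + 1, and
the right half of that half is of the form handled by the previous lemma. *)
Lemma dyadic_comb_porous a b : a < b -> b - a <= 1 ->
  exists c d, [/\ a <= c, c < d, d <= b, (b - a) / 8 <= d - c &
    forall z, dyadic_comb z -> z <= c \/ d <= z].
Proof.
move=> ab ab1; set m := (a + b) / 2; set k := Num.floor m.
have /andP[km mk] : k%:~R <= m < (k + 1)%:~R.
  by rewrite /k; exact: Num.Theory.floor_itv.
have mE : m = (a + b) / 2 by [].
(* Use [m, b] if it stays below k + 1; otherwise b - m <= 1 / 2 forces
   m > k + 1 / 2, hence a > k, and [a, m] is used. *)
have kE : (k + 1)%:~R = k%:~R + 1 :> R by rewrite intrD.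
have [bk|kb] := leP b (k + 1)%:~R.
  have [||||c [d [h1 h2 h3 h4 h5]]] := @dyadic_comb_gap_doubling k ((m + b) / 2) b.
  - lra.
  - lra.
  - lra.
  - lra.
  by exists c, d; split => //; lra.
have [||||c [d [h1 h2 h3 h4 h5]]] := @dyadic_comb_gap_doubling k ((a + m) / 2) m.
- lra.
- lra.
- lra.
- lra.
by exists c, d; split => //; lra.
Qed.

Lemma dyadic_comb_osc a b : a < b -> b - a <= 1 ->
  exists u v, [/\ a <= u <= b, a <= v <= b & (b - a) / 32 <=
    `|set_dist dyadic_comb u - set_dist dyadic_comb v|].
Proof.
move=> ab ab1; have [c [d [ac cd db h gap]]] := dyadic_comb_porous ab ab1.
have [u [v [/andP[u1 u2] /andP[v1 v2] uv]]] := set_dist_gap dyadic_comb0 cd gap.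
by exists u, v; split; [apply/andP; lra..|lra].
Qed.

Definition dyadic N : set R := [set x | 2 ^+ N * x \is a Num.int].

(** Grid points between k and k + 2^-N do not exist, so the points k + 2^-n
with n > N, which are off the grid, are never closer to a grid point than both
k and k + 2^-N, which are in the comb and on the grid. *)
Lemma dyadic_comb_dist N x : dyadic N x -> dyadic N (set_dist dyadic_comb x).
Proof.
move=> xN; have e0 := exp2N_gt0 N.
have E0 : 2 ^+ N != 0 :> R by rewrite lt0r_neq0// exprn_gt0.
have EV : 2 ^+ N * 2 ^- N = 1 :> R by rewrite mulfV.
have near z : dyadic_comb z -> exists2 w, dyadic_comb w /\ dyadic N w &
    `|x - w| <= `|x - z|.
  move=> [k [n zE]]; have [nN|Nn] := leqP n N.
    exists z => //; split; first by exists k, n.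
    rewrite /dyadic/= zE mulrDr rpredD//.
      by rewrite -natrX rpredM ?natr_int ?intr_int.
    by rewrite -(subnK nN) exprD mulfK ?lt0r_neq0 ?exprn_gt0// -natrX natr_int.
  have kN : dyadic N (k%:~R : R) by rewrite /dyadic/= -natrX rpredM ?natr_int ?intr_int.
  have [xk|kx] := leP x k%:~R.
    exists k%:~R; last first.
      by have n0 := exp2N_gt0 n; rewrite zE !ler0_norm; lra.
    by split=> //; exists (k - 1), 0%N; rewrite intrD expr0 invr1; ring.
  have [j xj] := intrP xN.
  have kxN : k%:~R + 2 ^- N <= x.
    have -> : x = 2 ^- N * j%:~R by rewrite -xj mulKf.
    have kE : k%:~R = 2 ^- N * ((2 ^ N)%N%:Z * k)%:~R :> R.
      by rewrite intrM -[(Posz _)%:~R]/((2 ^ N)%N%:R) natrX mulKf.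
    move: kx; rewrite -{1}[x](mulKf E0) xj kE ltr_pM2l// ltr_int -lezD1 => h.
    rewrite -{2}[2 ^- N]mulr1 -mulrDr ler_pM2l//.
    by rewrite (_ : 1 = 1%:~R)// -intrD ler_int.
  exists (k%:~R + 2 ^- N).
    by split; [exists k, N|rewrite /dyadic/= mulrDr EV rpredD// rpred1].
  by have Nn' := exp2N_lt Nn; have n0 := exp2N_gt0 n; rewrite zE !ger0_norm; lra.
have grid w : dyadic N w -> 2 ^+ N * `|x - w| \is a Num.int.
  move=> wN; rewrite -[2 ^+ N]ger0_norm ?exprn_ge0// -normrM mulrBr.
  by rewrite intrEge0 ?natr_norm_int ?rpredB.
have [z Zz zd] := set_dist_approx x dyadic_comb0 e0.
have [w [Zw wN] wz] := near z Zz.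
(* Distances between grid points are multiples of 2^-N, so a grid point of the
   comb that is less than 2^-N away from optimal is optimal. *)
suff -> : set_dist dyadic_comb x = `|x - w| by exact: grid.
apply/eqP; rewrite eq_le set_dist_le//=.
apply: set_dist_ge; first exact: dyadic_comb0.
move=> z' Zz'; have [w' [Zw' w'N] w'z] := near z' Zz'.
apply: le_trans w'z; have w'd := set_dist_le x Zw'.
have {w'd} : `|x - w| < `|x - w'| + 2 ^- N by lra.
have E1 : 0 < 2 ^+ N :> R by rewrite exprn_gt0.
rewrite -(ltr_pM2l E1) mulrDr EV -[_ <= _](ler_pM2l E1).
have [i ->] := intrP (grid _ wN); have [j ->] := intrP (grid _ w'N).
by rewrite -(intrD _ j 1) ltr_int ltzD1 ler_int.
Qed.

End dyadic_comb.

(** * Iterates and periodic points *)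

Section iterates.
Context {M : topologicalType}.
Implicit Types (f : homeomorphism M) (n : int) (p : M).

Lemma iterz_succ f n p : iterz f (n + 1) p = f (iterz f n p).
Proof.
case: n => [k|[|k]]; first by rewrite -PoszD addn1.
  by rewrite /= homeo_invK.
have -> : Negz k.+1 + 1 = Negz k by rewrite !NegzE -addn1 PoszD opprD addrNK.
by rewrite /= homeo_invK.
Qed.

Lemma iterz_pred f n p : iterz f (n - 1) p = homeo_inv f (iterz f n p).
Proof. by rewrite -[in RHS](subrK 1 n) iterz_succ homeo_funK. Qed.

Lemma iter_continuous (g : M -> M) k : continuous g -> continuous (iter k g).
Proof.
move=> gc; elim: k => [|k IHk] x /=; first exact: cvg_id.
exact: continuous_comp (IHk x) (gc _).
Qed.

Lemma iterz_continuous f n : continuous (iterz f n).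
Proof.
case: n => k; apply: iter_continuous.
- exact: homeo_fun_continuous.
- exact: homeo_inv_continuous.
Qed.

Lemma finite_invariant_periodic f (G : set M) p : finite_set G ->
  (forall q, G q -> G (f q)) -> G p -> exists k, iter k.+1 f p = p.
Proof.
move=> finG Gf Gp.
have Giter k : G (iter k f p) by elim: k => //= k; exact: Gf.
have iterI k : injective (iter k f).
  by elim: k => [|k IHk] // x y /= /(can_inj (homeo_funK f)); exact: IHk.
apply: contrapT => /forallNP aper; apply: infinite_nat.
rewrite (_ : [set: nat] = (fun k => iter k f p) @^-1` G); last first.
  by apply/esym/seteqP; split=> // k _; exact: Giter.
apply: finite_preimage => //.
have lt_neq i j : (i < j)%N -> iter i f p <> iter j f p.
  move=> ij; rewrite -(subnKC ij) addSn -addnS iterD => /iterI/esym.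
  exact: aper.
move=> i j _ _ /= ij; case: (ltngtP i j) => // h; exfalso.
- exact: lt_neq h ij.
- exact: lt_neq h (esym ij).
Qed.

Lemma dense_periodic_nonwandering f :
  (forall U, open U -> U !=set0 -> exists2 p, U p & exists k, iter k.+1 f p = p) ->
  wandering_set f = set0.
Proof.
move=> per; apply/seteqP; split => // x [U [oU Ux wU]].
have [p Up [k pk]] := per U oU (ex_intro _ x Ux).
have : (U `&` iterz f k.+1 @` U) p by split=> //; exists p.
by rewrite (wU k.+1).
Qed.

End iterates.

(** * Lifting from the torus to the plane *)

Section torus_lifts.
Context {R : realType}.
Implicit Types (x y z : R * R) (p q : torus R).

Lemma int_small_eq0 (t : R) : t \is a Num.int -> `|t| < 1 -> t = 0.
Proof.
move=> ti t1; apply/eqP/negP => /negP t0.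
by have := norm_intr_ge1 ti t0; rewrite leNgt t1.
Qed.

Lemma torus_lift_near x q (e : R) : torus_dist (torus_pi x) q < e ->
  exists2 y, torus_pi y = q & `|x - y| < e.
Proof.
rewrite -subr_gt0 => e0.
have [x' [y' [xx' <- h]]] := torus_dist_approx (torus_pi x) q e0.
have /torus_piP/andP[i1 i2] := esym xx'.
exists (y' + (x - x')); first by rewrite torus_pi_shift.
have -> : x - (y' + (x - x')) = x' - y'.
  by rewrite !opprD opprK addrCA addNKr addrC.
by apply: lt_le_trans h _; lra.
Qed.

Lemma norm_pair_ltP x (e : R) : (`|x| < e) = (`|x.1| < e) && (`|x.2| < e).
Proof. by rewrite -gt_max. Qed.

Lemma norm_pair_leP x (e : R) : (`|x| <= e) = (`|x.1| <= e) && (`|x.2| <= e).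
Proof. by rewrite -ge_max. Qed.

(** Another lift of torus_pi y that is closer to x would differ from y by an
integer vector of norm less than 1. *)
Lemma torus_dist_local x y : `|x - y| < 1 / 2 ->
  `|x - y| <= torus_dist (torus_pi x) (torus_pi y).
Proof.
move=> xy; rewrite leNgt; apply/negP => /torus_lift_near[z zy xz].
have /torus_piP/andP[i1 i2] := zy.
have := lt_trans xz xy; move: (xy); rewrite !norm_pair_ltP/=.
move=> /andP[xy1 xy2] /andP[xz1 xz2].
have eq_coord (a b c : R) : b - c \is a Num.int ->
    `|a - c| < 1 / 2 -> `|a - b| < 1 / 2 -> b = c.
  move=> bc /ltr_normlP[ac1 ac2] /ltr_normlP[ab1 ab2].
  by apply/subr0_eq/int_small_eq0 => //; apply/ltr_normlP; split; lra.
have zyE : z = y.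
  case: z y i1 i2 xy1 xy2 xz1 xz2 {zy xz xy} => [z1 z2] [y1 y2] /= *.
  by congr pair; [apply: (@eq_coord x.1)|apply: (@eq_coord x.2)].
by move: xz; rewrite zyE ltxx.
Qed.

Lemma torus_pi_open (O : set (R * R)) : open O -> open (torus_pi @` O).
Proof.
move=> oO; apply/torus_openE; rewrite openE => z [w Ow wz].
have /nbhs_ballP[e /= e0 we] : nbhs w O by apply: open_nbhs_nbhs.
apply/nbhs_ballP; exists e => //= z' zz'.
have /torus_piP/andP[i1 i2] := wz.
exists (z' + (w - z)); last by rewrite torus_pi_shift.
apply: we; move: zz'; rewrite -!ball_normE /=.
by have -> : w - (z' + (w - z)) = z - z' by rewrite !opprD opprK addrCA addNKr addrC.
Qed.

Lemma open_strip (a b : R) : open [set z : R * R | a < z.1 < b].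
Proof.
have -> : [set z : R * R | a < z.1 < b] = fst @^-1` [set` `]a, b[%R].
  by apply/seteqP; split => z /=; rewrite in_itv.
by apply: open_comp => [z _|]; [exact: cvg_fst|exact: interval_open].
Qed.

(** The first coordinate is only defined modulo 1, so the intermediate value
theorem needs smallness: the lifts of points of D that are near x have first
coordinate within 1/2 of t, hence the open strips on both sides of t have
disjoint images in the torus, and these separate D if t is not attained. *)
Lemma connected_torus_ivt (D : set (torus R)) (xi t : R) x y :
  connected D -> (forall p q, D p -> D q -> torus_dist p q <= xi) ->
  xi <= 1 / 8 -> D (torus_pi x) -> D (torus_pi y) -> `|x - y| <= 1 / 4 ->
  x.1 <= t <= y.1 -> exists2 z, D (torus_pi z) & z.1 = t.
Proof.
move=> Dc Dxi xi8 Dx Dy; rewrite norm_pair_leP => /andP[/= xy _] /andP[xt ty].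
move: xy => /ler_normlP[xy1 xy2].
apply: contrapT => noz.
have Nt z : D (torus_pi z) -> z.1 != t.
  by move=> Dz; apply/eqP => zt; apply: noz; exists z.
have {}xt : x.1 < t by rewrite lt_neqAle Nt.
have {}ty : t < y.1 by rewrite lt_neqAle eq_sym Nt.
pose U := torus_pi @` [set z : R * R | t - 1 / 2 < z.1 < t].
pose V := torus_pi @` [set z : R * R | t < z.1 < t + 1 / 2].
have oU : open U by apply/torus_pi_open/open_strip.
have oV : open V by apply/torus_pi_open/open_strip.
have UV p : U p -> V p -> False.
  move=> [u /= /andP[u1 u2] <-] [v /= /andP[v1 v2] /torus_piP/andP[i _]].
  have : v.1 - u.1 = 0.
    by apply: int_small_eq0 => //; apply/ltr_normlP; split; lra.
  lra.
have DUV p : D p -> U p \/ V p.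
  move=> Dp.
  have /torus_lift_near[w wp] : torus_dist (torus_pi x) p < 1 / 4.
    by apply: le_lt_trans (Dxi _ _ Dx Dp) _; lra.
  rewrite norm_pair_ltP => /andP[/= /ltr_normlP[w1 w2] _].
  have := Nt w; rewrite wp => /(_ Dp); rewrite neq_lt => /orP[wt|wt].
    by left; exists w => //=; apply/andP; split; lra.
  by right; exists w => //=; apply/andP; split; lra.
have DU : D `&` U = D.
  apply: Dc; [|by exists U|exists (~` V); first exact: open_closedC].
    exists (torus_pi x); split=> //; exists x => //=; apply/andP; split; lra.
  apply/seteqP; split => p [Dp Up]; split=> //; first by move/(UV p Up).
  by have [] := DUV p Dp.
have : (D `&` U) (torus_pi y) by rewrite DU.
move=> [_ Uy]; apply: UV Uy _; exists y => //=; apply/andP; split; lra.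
Qed.

Definition torus_map (g : R * R -> R * R) (p : torus R) : torus R :=
  torus_pi (g (repr p)).

Lemma torus_mapE g z : (forall x y, torus_pi x = torus_pi y ->
    torus_pi (g x) = torus_pi (g y)) ->
  torus_map g (torus_pi z) = torus_pi (g z).
Proof. by move=> gZ; apply: gZ; rewrite /torus_pi reprK. Qed.

Lemma torus_map_continuous g : (forall x y, torus_pi x = torus_pi y ->
    torus_pi (g x) = torus_pi (g y)) ->
  continuous g -> continuous (torus_map g).
Proof.
move=> gZ /continuousP gc; apply/continuousP => U oU; apply/torus_openE.
have -> : torus_pi @^-1` (torus_map g @^-1` U) = g @^-1` (torus_pi @^-1` U).
  by apply/seteqP; split => z /=; rewrite torus_mapE.
by apply: gc; apply/torus_openE.
Qed.

End torus_lifts.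

Section self_improving.
Context {R : realType}.

Lemma self_improving_set0 (S : set R) (lambda : R) :
  2 < lambda -> has_ubound S -> (forall s, S s -> 0 <= s) ->
  (forall s, S s -> exists2 s', S s' & lambda * s <= 2 * s') ->
  forall s, S s -> s = 0.
Proof.
move=> lam2 bS S0 impr s Ss; apply/eqP; rewrite eq_le S0// andbT.
have sup_le : lambda * sup S <= 2 * sup S.
  rewrite mulrC -ler_pdivlMr; last lra.
  apply: ge_sup; first by exists s.
  move=> r /impr[r' /(ub_le_sup bS) r'S rr']; rewrite ler_pdivlMr; last lra.
  by rewrite mulrC; lra.
have := ub_le_sup bS Ss; nra.
Qed.

End self_improving.

(** * The torus homeomorphism (x, y) |-> (phi x - y, x) *)

Section recurrence_map.
Context {R : realType}.
Variable phi : R -> R.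
Hypothesis phi_continuous : continuous phi.
Hypothesis phi_int : forall s t, s - t \is a Num.int -> phi s - phi t \is a Num.int.
Implicit Types x y z : R * R.

Definition rec_lift z : R * R := (phi z.1 - z.2, z.1).
Definition rec_lift_inv z : R * R := (z.2, phi z.2 - z.1).

Lemma rec_lift_int x y : torus_pi x = torus_pi y ->
  torus_pi (rec_lift x) = torus_pi (rec_lift y).
Proof.
move=> /torus_piP/andP[i1 i2]; apply/torus_piP; rewrite /= i1 andbT.
have -> : phi x.1 - x.2 - (phi y.1 - y.2) = (phi x.1 - phi y.1) - (x.2 - y.2).
  by ring.
by rewrite rpredB// phi_int.
Qed.

Lemma rec_lift_inv_int x y : torus_pi x = torus_pi y ->
  torus_pi (rec_lift_inv x) = torus_pi (rec_lift_inv y).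
Proof.
move=> /torus_piP/andP[i1 i2]; apply/torus_piP; rewrite /= i2 /=.
have -> : phi x.2 - x.1 - (phi y.2 - y.1) = (phi x.2 - phi y.2) - (x.1 - y.1).
  by ring.
by rewrite rpredB// phi_int.
Qed.

Lemma rec_lift_continuous : continuous rec_lift.
Proof.
move=> z; have c1 : phi x.1 @[x --> z] --> phi z.1.
  by apply: (@continuous_comp _ _ _ fst phi); [exact: cvg_fst|exact: phi_continuous].
have c2 : x.2 @[x --> z] --> z.2 by exact: cvg_snd.
exact: cvg_pair (cvgB c1 c2) cvg_fst.
Qed.

Lemma rec_lift_inv_continuous : continuous rec_lift_inv.
Proof.
move=> z; have c1 : phi x.2 @[x --> z] --> phi z.2.
  by apply: (@continuous_comp _ _ _ snd phi); [exact: cvg_snd|exact: phi_continuous].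
have c2 : x.1 @[x --> z] --> z.1 by exact: cvg_fst.
exact: cvg_pair cvg_snd (cvgB c1 c2).
Qed.

Lemma rec_liftK : cancel (torus_map rec_lift) (torus_map rec_lift_inv).
Proof.
move=> p; have [[x y] <-] := torus_pi_surj p.
rewrite (torus_mapE _ rec_lift_int) (torus_mapE _ rec_lift_inv_int).
by rewrite /rec_lift_inv/= subKr.
Qed.

Lemma rec_lift_invK : cancel (torus_map rec_lift_inv) (torus_map rec_lift).
Proof.
move=> p; have [[x y] <-] := torus_pi_surj p.
rewrite (torus_mapE _ rec_lift_inv_int) (torus_mapE _ rec_lift_int).
by rewrite /rec_lift/= subKr.
Qed.

Definition rec_homeo : homeomorphism (torus R) :=
  Homeomorphism rec_liftK rec_lift_invK
    (torus_map_continuous rec_lift_int rec_lift_continuous)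
    (torus_map_continuous rec_lift_inv_int rec_lift_inv_continuous).

Lemma rec_homeoE z : rec_homeo (torus_pi z) = torus_pi (rec_lift z).
Proof. exact: torus_mapE rec_lift_int. Qed.

Lemma rec_homeo_invE z :
  homeo_inv rec_homeo (torus_pi z) = torus_pi (rec_lift_inv z).
Proof. exact: torus_mapE rec_lift_inv_int. Qed.

(** [S] collects the gaps between first coordinates of nearby lifts of two
points of the same iterate of the continuum. The interval between two
such coordinates is stretched by phi, and x_(n+1) + x_(n-1) = phi(x_n) passes
the gain on to the next or to the previous iterate. *)
Lemma rec_homeo_cw_expansive (L lambda : R) : 0 <= L -> 2 < lambda ->
  (forall s t, `|phi s - phi t| <= L * `|s - t|) ->
  (forall a b, a < b -> b - a <= 1 -> exists u v,
    [/\ a <= u <= b, a <= v <= b & lambda * (b - a) <= `|phi u - phi v|]) ->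
  cw_expansive rec_homeo.
Proof.
move=> L0 lam2 lip osc; pose xi : R := ((L + 2) * 8)^-1.
(* With this value phi moves lifts that are 2 xi apart to lifts less than 1/2
   apart, so that they remain the nearest lifts of their images. *)
have xi0 : 0 < xi by rewrite invr_gt0; lra.
have xiE : (L + 2) * xi = 1 / 8.
  by rewrite /xi invfM mulrA mulfV ?mul1r//; apply/eqP; lra.
have xi8 : xi <= 1 / 16 by nra.
exists xi => // C [[c0 Cc0] _ Cc] diamC.
pose D n := iterz rec_homeo n @` C.
have Dxi n p q : D n p -> D n q -> torus_dist p q <= xi.
  move=> Dp Dq; rewrite -lee_fin; apply: le_trans (diamC n).
  by apply: ereal_sup_ubound; exists p => //; exists q.
have Dconn n : connected (D n).
  apply: connected_continuous_connected => //.
  by apply: continuous_subspaceT; exact: iterz_continuous.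
have Dsucc n z : D n (torus_pi z) -> D (n + 1) (torus_pi (rec_lift z)).
  by move=> [c Cc' cz]; exists c => //; rewrite iterz_succ cz rec_homeoE.
have Dpred n z : D n (torus_pi z) -> D (n - 1) (torus_pi (rec_lift_inv z)).
  by move=> [c Cc' cz]; exists c => //; rewrite iterz_pred cz rec_homeo_invE.
pose close n x y :=
  [/\ D n (torus_pi x), D n (torus_pi y) & `|x - y| <= 2 * xi].
have close_of_lt n x y : D n (torus_pi x) -> D n (torus_pi y) ->
    `|x - y| < 1 / 2 -> close n x y.
  move=> Dx Dy /torus_dist_local xy; split=> //.
  by apply: le_trans xy _; apply: le_trans (Dxi _ _ _ Dx Dy) _; lra.
have close_coord n x y : close n x y ->
    `|x.1 - y.1| <= 2 * xi /\ `|x.2 - y.2| <= 2 * xi.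
  by move=> [_ _]; rewrite norm_pair_leP => /andP[].
have close_lift (t s r w : R) : `|t - s| <= 2 * xi -> `|r - w| <= 2 * xi ->
    `|phi t - phi s - (r - w)| < 1 / 2.
  move=> ts rw; have := lip t s => lipts.
  apply: le_lt_trans (ler_normB _ _) _; nra.
have close_succ n x y : close n x y -> close (n + 1) (rec_lift x) (rec_lift y).
  move=> xy; have [xy1 xy2] := close_coord _ _ _ xy; case: xy => Dx Dy _.
  apply: close_of_lt; [exact: Dsucc|exact: Dsucc|].
  rewrite norm_pair_ltP /=; apply/andP; split; last by lra.
  have -> : phi x.1 - x.2 - (phi y.1 - y.2) = phi x.1 - phi y.1 - (x.2 - y.2).
    by ring.
  exact: close_lift.
have close_pred n x y : close n x y ->
    close (n - 1) (rec_lift_inv x) (rec_lift_inv y).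
  move=> xy; have [xy1 xy2] := close_coord _ _ _ xy; case: xy => Dx Dy _.
  apply: close_of_lt; [exact: Dpred|exact: Dpred|].
  rewrite norm_pair_ltP /=; apply/andP; split; first by lra.
  have -> : phi x.2 - x.1 - (phi y.2 - y.1) = phi x.2 - phi y.2 - (x.1 - y.1).
    by ring.
  exact: close_lift.
pose S := [set s : R | exists n x y, close n x y /\ s = `|x.1 - y.1|].
have S_eq0 s : S s -> s = 0.
  apply: (@self_improving_set0 R S lambda) => //.
  - by exists (2 * xi) => _ [n [x [y [/close_coord[? _] ->]]]].
  - by move=> _ [n [x [y [_ ->]]]].
  move=> {}s [n [x [y [xy ->]]]].
  wlog xy1 : x y xy / x.1 <= y.1.
    move=> wl; have [/(wl _ _ xy)//|/ltW/wl] := leP x.1 y.1.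
    rewrite distrC; apply; case: xy => ? ? ?; split=> //.
    by rewrite distrC.
  move: xy1; rewrite le_eqVlt => /predU1P[xyE|xy1].
    by exists `|x.1 - y.1|; [exists n, x, y|rewrite xyE subrr normr0; lra].
  have [/ler_normlP[xyxi _] _] := close_coord _ _ _ xy.
  have [u [v [/andP[xu uy] /andP[xv vy] huv]]] := osc _ _ xy1 ltac:(lra).
  have [Dx Dy nxy] := xy.
  have [z Dz zu] : exists2 z, D n (torus_pi z) & z.1 = u.
    apply: (@connected_torus_ivt R (D n) xi u x y (Dconn n) (@Dxi n)) => //.
    - lra.
    - by apply: le_trans nxy _; lra.
    - by rewrite xu uy.
  have [w Dw wv] : exists2 w, D n (torus_pi w) & w.1 = v.
    apply: (@connected_torus_ivt R (D n) xi v x y (Dconn n) (@Dxi n)) => //.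
    - lra.
    - by apply: le_trans nxy _; lra.
    - by rewrite xv vy.
  (* The lift w found above has the right first coordinate, but its second one
     may be far from z; replace it by the lift of the same point nearest to z. *)
  have [w' [Dw' w'v zw']] : exists w', [/\ D n (torus_pi w'), w'.1 = v &
      `|z - w'| < 2 * xi].
    have /torus_lift_near[w' w'w zw'] :
        torus_dist (torus_pi z) (torus_pi w) < 2 * xi.
      by apply: le_lt_trans (Dxi _ _ _ Dz Dw) _; lra.
    exists w'; split=> //; first by rewrite w'w.
    move: zw'; rewrite norm_pair_ltP /= => /andP[/ltr_normlP[zw1 zw2] _].
    have /torus_piP/andP[i1 _] := w'w.
    rewrite -wv; apply/subr0_eq/int_small_eq0 => //.
    by apply/ltr_normlP; split; lra.
  have zw : close n z w' by split=> //; exact: ltW.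
  have := close_succ _ _ _ zw; have := close_pred _ _ _ zw => cp cs.
  have nxyE : `|x.1 - y.1| = y.1 - x.1 by rewrite ltr0_norm; lra.
  pose s1 := `|phi u - z.2 - (phi v - w'.2)|; pose s2 := `|z.2 - w'.2|.
  have Ss1 : S s1.
    exists (n + 1), (rec_lift z), (rec_lift w'); split=> //.
    by rewrite /= zu w'v.
  have Ss2 : S s2 by exists (n - 1), (rec_lift_inv z), (rec_lift_inv w').
  have s12 : `|phi u - phi v| <= s1 + s2.
    have -> : phi u - phi v = (phi u - z.2 - (phi v - w'.2)) + (z.2 - w'.2).
      by ring.
    exact: ler_normD.
  rewrite nxyE; have [h|h] := leP s1 s2.
    by exists s2 => //; lra.
  by exists s1 => //; lra.
exists c0; apply/seteqP; split => [p Cp|_ ->//].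
have D0 q : C q -> D 0 q by move=> Cq; exists q.
have [x xc0] := torus_pi_surj c0.
have /torus_lift_near[y yp xy] : torus_dist (torus_pi x) p < 2 * xi.
  by rewrite xc0; apply: le_lt_trans (Dxi 0 _ _ (D0 _ Cc0) (D0 _ Cp)) _; lra.
have cxy : close 0 x y by split; rewrite ?xc0 ?yp; [exact: D0..|exact: ltW].
have e1 : x.1 = y.1.
  by apply/subr0_eq/normr0_eq0/S_eq0; exists 0, x, y.
(* A second coordinate is the first coordinate of the preimage. *)
have e2 : x.2 = y.2.
  apply/subr0_eq/normr0_eq0/S_eq0.
  by exists (0 - 1), (rec_lift_inv x), (rec_lift_inv y); split=> //; exact: close_pred.
by rewrite -yp -xc0 [x]surjective_pairing e1 e2 -surjective_pairing.
Qed.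

End recurrence_map.

(** * The example *)

Section comb_map.
Context {R : realType}.
Implicit Types (s t : R) (z : R * R).

(** The oscillation constant 1/32 of the distance function gives a stretching
factor 160 / 32 - 2 = 3 > 2; the integer 160 preserves dyadic grids. *)
Definition comb_fun s : R := 2 * s + 160 * set_dist dyadic_comb s.

Lemma comb_fun_lipschitz s t : `|comb_fun s - comb_fun t| <= 162 * `|s - t|.
Proof.
have -> : comb_fun s - comb_fun t =
    2 * (s - t) + 160 * (set_dist dyadic_comb s - set_dist dyadic_comb t).
  by rewrite /comb_fun; ring.
apply: le_trans (ler_normD _ _) _; rewrite !normrM (@ger0_norm _ 2)// (@ger0_norm _ 160)//.
by have := set_dist_lipschitz s t (@dyadic_comb0 R); lra.
Qed.

Lemma comb_fun_continuous : continuous comb_fun.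
Proof.
move=> s; apply/cvgrPdist_lt => e e0.
apply/nbhs_ballP; exists (e / 162); first by rewrite /= divr_gt0.
move=> t st; have {}st : `|s - t| < e / 162 by [].
apply: le_lt_trans (comb_fun_lipschitz s t) _.
by rewrite mulrC -ltr_pdivlMr.
Qed.

Lemma comb_fun_int s t :
  s - t \is a Num.int -> comb_fun s - comb_fun t \is a Num.int.
Proof.
move=> st; rewrite /comb_fun (dyadic_comb_int st).
have -> : 2 * s + 160 * set_dist dyadic_comb t -
  (2 * t + 160 * set_dist dyadic_comb t) = 2 * (s - t) by ring.
by rewrite rpredM ?natr_int.
Qed.

Lemma comb_fun_osc a b : a < b -> b - a <= 1 -> exists u v,
  [/\ a <= u <= b, a <= v <= b & 3 * (b - a) <= `|comb_fun u - comb_fun v|].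
Proof.
move=> ab ab1; have [u [v [ub vb uv]]] := dyadic_comb_osc ab ab1.
exists u, v; split=> //.
have uvb : `|2 * (u - v)| <= 2 * (b - a).
  rewrite normrM ger0_norm// ler_pM2l//.
  by move/andP: ub => [? ?]; move/andP: vb => [? ?]; apply/ler_normlP; split; lra.
have dE : 160 * (set_dist dyadic_comb u - set_dist dyadic_comb v) =
    comb_fun u - comb_fun v - 2 * (u - v) by rewrite /comb_fun; ring.
have := ler_normB (comb_fun u - comb_fun v) (2 * (u - v)).
by rewrite -dE normrM (@ger0_norm _ 160)//; lra.
Qed.

Definition comb_homeo : homeomorphism (torus R) :=
  rec_homeo comb_fun_continuous comb_fun_int.

Lemma comb_homeo_cw_expansive : cw_expansive comb_homeo.
Proof.
apply: rec_homeo_cw_expansive comb_fun_lipschitz comb_fun_osc => //.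
by rewrite ltr_nat.
Qed.

Lemma comb_homeo_fixed t : dyadic_comb t -> fixed_points comb_homeo (torus_pi (t, t)).
Proof.
move=> tZ; rewrite /fixed_points/mkset /comb_homeo rec_homeoE /rec_lift/= /comb_fun.
by rewrite set_dist_eq0// mulr0 addr0 mulr_natl mulr2n addrK.
Qed.

Lemma comb_homeo_infinite_fixed : infinite_set (fixed_points comb_homeo).
Proof.
pose p n : torus R := torus_pi (2 ^- n.+1, 2 ^- n.+1).
have pfix n : fixed_points comb_homeo (p n).
  by apply: comb_homeo_fixed; exists 0, n.+1; rewrite add0r.
have neq n m : (n < m)%N -> p n <> p m.
  move=> nm /torus_piP/andP[/= i _].
  have := @exp2N_lt R n.+1 m.+1 nm; have := @exp2N_lt R 0 n.+1 isT.
  rewrite expr0 invr1; have m0 := @exp2N_gt0 R m.+1 => n1 h.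
  have := int_small_eq0 i; rewrite ltr_norml => /(_ ltac:(apply/andP; lra)).
  lra.
move=> fin; apply: infinite_nat.
rewrite (_ : [set: nat] = p @^-1` fixed_points comb_homeo); last first.
  by apply/esym/seteqP; split=> // n _; exact: pfix.
apply: finite_preimage => // n m _ _ /= nm; case: (ltngtP n m) => // h; exfalso.
- exact: neq h nm.
- exact: neq h (esym nm).
Qed.

Definition dyadic_torus N : set (torus R) :=
  torus_pi @` [set z | dyadic N z.1 /\ dyadic N z.2].

Lemma dyadic_torus_finite N : finite_set (dyadic_torus N).
Proof.
pose c (ij : 'I_(2 ^ N) * 'I_(2 ^ N)) : torus R :=
  torus_pi (2 ^- N * ij.1%:R, 2 ^- N * ij.2%:R).
apply: (@sub_finite_set _ _ (c @` setT)); last exact: finite_image.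
have E0 : 2 ^+ N != 0 :> R by rewrite lt0r_neq0// exprn_gt0.
have red t : dyadic N t ->
    exists i : 'I_(2 ^ N), 2 ^- N * i%:R - t \is a Num.int.
  move=> /intrP[m tm].
  have N0 : ((2 ^ N)%N : int) != 0 by rewrite eqz_nat -lt0n expn_gt0.
  have mlt : (`|(m %% (2 ^ N)%N)%Z| < 2 ^ N)%N.
    rewrite -ltz_nat gez0_abs ?modz_ge0//.
    by have := ltz_mod m N0.
  exists (Ordinal mlt).
  have mE : m%:~R = (m %/ (2 ^ N)%N)%Z%:~R * 2 ^+ N + (Ordinal mlt)%:R :> R.
    rewrite {1}(divz_eq m (2 ^ N)%N) intrD intrM -natrX; congr (_ + _).
    by rewrite -[RHS]/((Posz _)%:~R) /= gez0_abs ?modz_ge0.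
  have -> : 2 ^- N * (Ordinal mlt)%:R - t = - (m %/ (2 ^ N)%N)%Z%:~R.
    by apply: (mulfI E0); rewrite mulrBr mulVKf// tm mE; ring.
  by rewrite rpredN intr_int.
move=> _ [z [/red[i zi] /red[j zj]] <-]; exists (i, j) => //.
by apply/torus_piP; rewrite /= zi zj.
Qed.

Lemma comb_homeo_dyadic N p : dyadic_torus N p -> dyadic_torus N (comb_homeo p).
Proof.
move=> [z [z1 z2] <-]; rewrite /comb_homeo rec_homeoE.
exists (rec_lift comb_fun z) => //; split => //=; rewrite /dyadic /=.
have -> : 2 ^+ N * (comb_fun z.1 - z.2) = 2 * (2 ^+ N * z.1) +
    160 * (2 ^+ N * set_dist dyadic_comb z.1) - 2 ^+ N * z.2.
  by rewrite /comb_fun; ring.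
apply: rpredB => //; apply: rpredD; apply: rpredM; rewrite ?natr_int//.
exact: dyadic_comb_dist.
Qed.

Lemma dyadic_approx (t e : R) : 0 < e -> exists N, forall M, (N <= M)%N ->
  exists2 s, dyadic M s & `|t - s| < e.
Proof.
move=> e0; exists (Num.bound e^-1) => M NM.
have E1 : 0 < 2 ^+ M :> R by rewrite exprn_gt0.
have E0 := lt0r_neq0 E1.
have eM : e^-1 < 2 ^+ M.
  apply: lt_le_trans (archi_boundP _) _; first by rewrite invr_ge0 ltW.
  by rewrite -natrX ler_nat; apply: leq_trans NM (ltnW (ltn_expl _ _)).
exists (2 ^- M * (Num.floor (2 ^+ M * t))%:~R).
  by rewrite /dyadic/= mulVKf// intr_int.
rewrite -(ltr_pM2l E1) -{1}[2 ^+ M]gtr0_norm// -normrM mulrBr mulVKf//.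
have : 1 < 2 ^+ M * e by rewrite -ltr_pdivrMr// mul1r.
have /andP[] := Num.Theory.floor_itv (2 ^+ M * t); rewrite intrD => h1 h2 h3.
rewrite ltr_norml; apply/andP; lra.
Qed.

Lemma dyadic_torus_dense (U : set (torus R)) : open U -> U !=set0 ->
  exists2 p, U p & exists N, dyadic_torus N p.
Proof.
move=> /torus_openE oU [q Uq]; have [z zq] := torus_pi_surj q.
have /nbhs_ballP[e /= e0 zU] : nbhs z (torus_pi @^-1` U).
  by apply: open_nbhs_nbhs; split; rewrite /= ?zq.
have [N1 h1] := dyadic_approx z.1 e0; have [N2 h2] := dyadic_approx z.2 e0.
have [s1 d1 zs1] := h1 _ (leq_maxl N1 N2).
have [s2 d2 zs2] := h2 _ (leq_maxr N1 N2).
exists (torus_pi (s1, s2)).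
  by apply: zU; rewrite -ball_normE /= norm_pair_ltP /= zs1 zs2.
by exists (maxn N1 N2), (s1, s2).
Qed.

Lemma comb_homeo_nonwandering : wandering_set comb_homeo = set0.
Proof.
apply: dense_periodic_nonwandering => U oU /(dyadic_torus_dense oU)[p Up [N pN]].
exists p => //; apply: finite_invariant_periodic (dyadic_torus_finite N) _ pN.
exact: comb_homeo_dyadic.
Qed.

End comb_map.

Theorem theorem4 (R : realType) :
  exists f : homeomorphism (torus R),
    [/\ cw_expansive f, infinite_set (fixed_points f) & wandering_set f = set0].
Proof.
exists comb_homeo; split.
- exact: comb_homeo_cw_expansive.
- exact: comb_homeo_infinite_fixed.
- exact: comb_homeo_nonwandering.
Qed.
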